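(* Let $f:\mathbb{R}^d\to\mathbb{R}$ be a convex, differentiable, $L$-smooth function which has a minimizer $x^*\in\arg\min_{x\in\mathbb{R}^d} f(x)$, and let $f^*=f(x^* )$. Suppose $f$ is accessed through a stochastic first-order oracle that is unbiased and has noise with $p$-th moment bounded by $\sigma^p$, for some $\sigma>0$ and $p\in(1,2]$. Let $T\ge 1$ be an integer, let $\delta\in(0,1)$, let $x_1\in\mathbb{R}^d$ be the initial point and $R_1=\|x_1-x^*\|$. Run Clipped-SGD for $T$ iterations from $x_1$ with the constant parameters $$\lambda_t=\lambda=\max\left\{(16T)^{1/p}\sigma,\ \sqrt{2}\,L R_1\right\},$$ $$\eta_t=\eta=\frac{R_1}{16\lambda\ln\frac{4T}{\delta}}=\frac{R_1}{16\ln\frac{4T}{\delta}}\min\left\{(16T)^{-1/p}\sigma^{-1},\ (\sqrt{2}\,LR_1)^{-1}\right\}.$$ Then, with probability at least $1-\delta$, the iterate sequence $(x_t)_{t\ge1}$ satisfies $$\frac1T\sum_{t=1}^T\left[f(x_t)-f^*\right]\le 32R_1\ln\frac{4T}{\delta}\,\max\left\{16^{1/p}\,T^{\frac{1-p}{p}}\sigma,\ \sqrt{2}\,LR_1T^{-1}\right\}.$$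
   Context: $\|\cdot\|$ is the Euclidean norm. $f$ is $L$-smooth if $\|\nabla f(x)-\nabla f(y)\|\le L\|x-y\|$ for all $x,y\in\mathbb{R}^d$. Stochastic oracle: when queried at $x$, it returns a history-independent random vector $\widehat{\nabla} f(x)$ such that, conditioned on the history and the queried point $x$, $\mathbb{E}[\widehat{\nabla} f(x)\mid x]=\nabla f(x)$ (unbiasedness) and $\mathbb{E}[\|\widehat{\nabla} f(x)-\nabla f(x)\|^p\mid x]\le\sigma^p$ (bounded $p$-th moment noise). Clipped-SGD with (deterministic) initial point $x_1$, step sizes $\{\eta_t\}$ and clipping parameters $\{\lambda_t\}$: for $t=1,\dots,T$, query the oracle at $x_t$ to obtain $\widehat{\nabla} f(x_t)$, set $$\widetilde{\nabla} f(x_t)=\min\left\{1,\frac{\lambda_t}{\|\widehat{\nabla} f(x_t)\|}\right\}\widehat{\nabla} f(x_t)$$ (equal to $0$ if $\widehat{\nabla} f(x_t)=0$), and $x_{t+1}=x_t-\eta_t\widetilde{\nabla} f(x_t)$. *)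

(* Defs.v *)
From HB Require Import structures.
From mathcomp Require Import all_boot all_order all_algebra.
From mathcomp Require Import all_classical all_reals all_analysis.

Set Implicit Arguments.
Unset Strict Implicit.
Unset Printing Implicit Defensive.

Import Order.TTheory GRing.Theory Num.Theory.
Import numFieldNormedType.Exports.

Local Open Scope classical_set_scope.
Local Open Scope ring_scope.

(* R^d with its Borel sigma-algebra; convertible to 'rV[R]_d.  The library's
   norm on 'rV[R]_d is the sup norm, which has the same open sets as the
   Euclidean one. *)
Notation borel_rV R d := (g_sigma_algebraType (@open 'rV[R]_d)).

Definition enorm (R : realType) (d : nat) (v : 'rV[R]_d) : R :=
  Num.sqrt (\sum_j v 0 j ^+ 2).

Definition gradient (R : realType) (d : nat) (f : 'rV[R]_d -> R)
    (x : 'rV[R]_d) : 'rV[R]_d :=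
  \row_j 'D_(delta_mx 0 j) f x.

Definition smooth (R : realType) (d : nat) (L : R) (f : 'rV[R]_d -> R) :=
  forall x y, enorm (gradient f x - gradient f y) <= L * enorm (x - y).

(* A stochastic first-order oracle is a probability kernel: Q x is the law of
   the answer to a query at x.  It is a function of x alone, which is the
   history-independence of the oracle. *)
Definition unbiased (R : realType) (d : nat) (f : 'rV[R]_d -> R)
    (Q : R.-pker (borel_rV R d) ~> (borel_rV R d)) :=
  forall (x : borel_rV R d) (j : 'I_d),
    (Q x).-integrable setT (fun v : borel_rV R d => (v 0 j)%:E) /\
    (\int[Q x]_v (v 0 j)%:E = (gradient f x 0 j)%:E)%E.

Definition moment_bounded (R : realType) (d : nat) (f : 'rV[R]_d -> R)
    (p sigma : R) (Q : R.-pker (borel_rV R d) ~> (borel_rV R d)) :=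
  forall x : borel_rV R d,
    (\int[Q x]_v (enorm (v - gradient f x) `^ p)%:E
      <= (sigma `^ p)%:E)%E.

(* The sigma-algebra generated by the answers g_1, ..., g_(t-1) received before
   round t; the points queried so far are functions of these. *)
Definition history (R : realType) (d : nat) (T : Type)
    (g : nat -> T -> borel_rV R d) (t : nat) : set (set T) :=
  <<s \bigcup_(s in [set s | (1 <= s < t)%N])
        preimage_set_system setT (g s) measurable >>.

(* In each round t = 1, ..., N the oracle Q is queried at x_t and answers g_t:
   the conditional law of g_t given the history is Q (x_t). *)
Definition answers (R : realType) (d : nat) (dO : measure_display)
    (Omega : measurableType dO) (P : probability Omega R)
    (Q : R.-pker (borel_rV R d) ~> (borel_rV R d)) (N : nat)
    (x : nat -> Omega -> 'rV[R]_d) (g : nat -> Omega -> borel_rV R d) :=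
  forall t, (1 <= t <= N)%N ->
    measurable_fun setT (g t) /\
    forall (A : set Omega) (B : set (borel_rV R d)),
      history g t A -> measurable B ->
      (P (A `&` g t @^-1` B) = \int[P]_(w in A) Q (x t w) B)%E.

(* Since r *: 0 = 0, the value at v = 0 is 0 whatever 0^-1 is. *)
Definition clip (R : realType) (d : nat) (lam : R) (v : 'rV[R]_d) : 'rV[R]_d :=
  Num.min 1 (lam / enorm v) *: v.

(* Rounds are numbered from 1; the values x 0 and g 0 are irrelevant. *)
Definition clipped_sgd (R : realType) (d : nat) (Omega : Type) (x1 : 'rV[R]_d)
    (eta lam : nat -> R) (N : nat) (g x : nat -> Omega -> 'rV[R]_d) :=
  (forall w, x 1%N w = x1) /\
  forall t, (1 <= t <= N)%N -> forall w,
    x t.+1 w = x t w - eta t *: clip (lam t) (g t w).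

(* Main.v *)
From HB Require Import structures.
Require Import Defs.
From mathcomp Require Import all_boot all_order all_algebra.
From mathcomp Require Import all_classical all_reals all_analysis.
From mathcomp Require Import measurable_realfun.
From mathcomp Require Import ring lra.

(* Let D_t = |x_t - xs|^2, Delta_t = f(x_t) - f(xs), a = ln (4 T / delta) and
   Phi_t = D_t + eta * \sum_(s < t) Delta_s.  With k = 2 a / R1^2, as long as
   D_t <= (3/2) R1^2, the conditional expectation of exp (k (Phi_(t+1) - Phi_t))
   is at most 1 + 1/T: in this region |grad f(x_t)| <= (7/8) lam, so clipping
   alters only answers whose noise exceeds lam/8, and both the bias and the
   variance are controlled by the p-th moment of noise / lam, which is at most
   1/(16 T), while the part linear in the noise has mean zero.  Freezing Phi
   once it exceeds (3/2) R1^2 and applying Markov's inequality to exp (k Phi),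
   we get Phi_(T+1) <= (3/2) R1^2 with probability at least
   1 - e exp (- a) >= 1 - delta.  On this event eta * \sum Delta_t
   <= (3/2) R1^2, which is slightly stronger than the stated bound. *)

Set Implicit Arguments.
Unset Strict Implicit.
Unset Printing Implicit Defensive.

Import Order.TTheory GRing.Theory Num.Theory.
Import numFieldNormedType.Exports.

Local Open Scope classical_set_scope.
Local Open Scope ring_scope.

(** * Euclidean vectors and clipping *)

Definition dot (R : realType) (d : nat) (u v : 'rV[R]_d) : R :=
  \sum_j u 0 j * v 0 j.

Section euclid.
Context {R : realType} {d : nat}.
Implicit Types (u v w : 'rV[R]_d) (a : R).

Lemma dotC u v : dot u v = dot v u.
Proof. by apply: eq_bigr => j _; rewrite mulrC. Qed.

Lemma dotDl u v w : dot (u + v) w = dot u w + dot v w.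
Proof. by rewrite -big_split; apply: eq_bigr => j _; rewrite mxE mulrDl. Qed.

Lemma dotZl a u w : dot (a *: u) w = a * dot u w.
Proof. by rewrite mulr_sumr; apply: eq_bigr => j _; rewrite mxE mulrA. Qed.

Lemma dotNl u w : dot (- u) w = - dot u w.
Proof. by rewrite -scaleN1r dotZl mulN1r. Qed.

Lemma dotBl u v w : dot (u - v) w = dot u w - dot v w.
Proof. by rewrite dotDl dotNl. Qed.

Lemma dotBr u v w : dot w (u - v) = dot w u - dot w v.
Proof. by rewrite dotC dotBl !(dotC w). Qed.

Lemma dotZr a u w : dot u (a *: w) = a * dot u w.
Proof. by rewrite dotC dotZl dotC. Qed.

Lemma dot_ge0 u : 0 <= dot u u.
Proof. by apply: sumr_ge0 => j _; rewrite -expr2 sqr_ge0. Qed.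

Lemma enorm_ge0 u : 0 <= enorm u.
Proof. exact: sqrtr_ge0. Qed.

Lemma enorm_sqr u : enorm u ^+ 2 = dot u u.
Proof.
rewrite sqr_sqrtr; first by apply: eq_bigr => j _; rewrite expr2.
by apply: sumr_ge0 => j _; exact: sqr_ge0.
Qed.

Lemma enormE u : enorm u = Num.sqrt (dot u u).
Proof. by rewrite -enorm_sqr sqrtr_sqr ger0_norm// enorm_ge0. Qed.

Lemma enorm_eq0 u : enorm u = 0 -> u = 0.
Proof.
move=> u0; apply/rowP => j; rewrite mxE; apply/eqP.
rewrite -sqrf_eq0 eq_le sqr_ge0 andbT.
have -> : 0 = dot u u by rewrite -enorm_sqr u0 expr0n.
rewrite /dot (bigD1 j)//= -expr2 lerDl; apply: sumr_ge0 => i _.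
by rewrite -expr2 sqr_ge0.
Qed.

Lemma enormZ a u : enorm (a *: u) = `|a| * enorm u.
Proof.
by rewrite !enormE dotZl dotZr mulrA -expr2 sqrtrM ?sqr_ge0// sqrtr_sqr.
Qed.

Lemma enormN u : enorm (- u) = enorm u.
Proof. by rewrite -scaleN1r enormZ normrN1 mul1r. Qed.

(** Cauchy-Schwarz: the squared norm of [enorm v ^+ 2 *: u - dot u v *: v] is [enorm v ^+ 2] times
    the gap between the squares of the two sides. *)
Lemma dot_le u v : `|dot u v| <= enorm u * enorm v.
Proof.
have [v0|v0] := eqVneq (enorm v) 0.
  rewrite v0 mulr0 (enorm_eq0 v0) /dot big1 ?normr0// => j _.
  by rewrite mxE mulr0.
have vgt0 : 0 < enorm v by rewrite lt_neqAle eq_sym v0 enorm_ge0.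
rewrite -ler_sqr ?nnegrE ?mulr_ge0 ?enorm_ge0//.
rewrite -(ler_pM2l (exprn_gt0 2 vgt0)) real_normK ?num_real// -subr_ge0.
have := dot_ge0 (enorm v ^+ 2 *: u - dot u v *: v).
rewrite dotBl !dotBr !dotZl !dotZr (dotC v u) -!enorm_sqr.
set s := enorm u; set t := enorm v; set c := dot u v.
by congr (0 <= _); ring.
Qed.

Lemma enormD u v : enorm (u + v) <= enorm u + enorm v.
Proof.
rewrite -ler_sqr ?nnegrE ?addr_ge0 ?enorm_ge0//.
have := dot_le u v; rewrite ler_norml => /andP[_].
rewrite enorm_sqr dotDl !(dotC _ (u + v)) !dotDl (dotC v u) -!enorm_sqr.
by lra.
Qed.

Lemma enormB_sqr u v :
  enorm (u - v) ^+ 2 = enorm u ^+ 2 - 2 * dot u v + enorm v ^+ 2.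
Proof. by rewrite !enorm_sqr dotBl !dotBr (dotC v u); ring. Qed.

Lemma enormD_sqr_le u v :
  enorm (u + v) ^+ 2 <= 2 * enorm u ^+ 2 + 2 * enorm v ^+ 2.
Proof.
have := sqr_ge0 (enorm (u - v)); rewrite enormB_sqr.
have := enormB_sqr u (- v); rewrite opprK enormN dotC dotNl dotC => ->.
by lra.
Qed.

(** Clipping is radial, so it moves [v] by exactly the part of its norm beyond [lam]. *)
Lemma enorm_clip_subr (lam : R) v : 0 < lam ->
  enorm (clip lam v - v) = Num.max 0 (enorm v - lam).
Proof.
move=> lam0; rewrite /clip -[X in _ - X]scale1r -scalerBl enormZ.
have [v0|v0] := eqVneq (enorm v) 0.
  by rewrite v0 mulr0 sub0r max_l// oppr_le0 ltW.
have vgt0 : 0 < enorm v by rewrite lt_neqAle eq_sym v0 enorm_ge0.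
have [lev|ltv] := leP (enorm v) lam.
  rewrite min_l ?ler_pdivlMr ?mul1r// subrr normr0 mul0r max_l//.
  by rewrite subr_le0.
rewrite min_r ?ler_pdivrMr ?mul1r ?(ltW ltv)//.
rewrite ler0_norm ?subr_le0 ?ler_pdivrMr ?mul1r ?(ltW ltv)//.
by rewrite opprB mulrBl mul1r divfK// max_r// subr_ge0 ltW.
Qed.

Lemma enorm_clip_le (lam : R) v : 0 < lam -> enorm (clip lam v) <= lam.
Proof.
move=> lam0; rewrite /clip enormZ.
have [v0|v0] := eqVneq (enorm v) 0; first by rewrite v0 mulr0 ltW.
have vgt0 : 0 < enorm v by rewrite lt_neqAle eq_sym v0 enorm_ge0.
rewrite ger0_norm; last by rewrite le_min ler01 divr_ge0// ltW.
by rewrite -ler_pdivlMr// ge_min lexx orbT.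
Qed.

End euclid.

(** * Elementary inequalities and the exponential of a clipped vector *)

Lemma expR_le_quad (R : realType) (y : R) :
  y <= 3 / 4 -> expR y <= 1 + y + 4 * y ^+ 2.
Proof.
move=> y34; have y1 : 0 < 1 - y by lra.
have : (1 - y) * expR y <= 1.
  have : 1 - y <= expR (- y) by have := expR_ge1Dx (- y).
  by rewrite -(ler_pM2r (expR_gt0 y)) -expRD addNr expR0.
rewrite mulrC -ler_pdivlMr// => /le_trans; apply.
(* [(1 - y) * (1 + y + 4 * y ^+ 2) = 1 + y ^+ 2 * (3 - 4 * y)], whence the threshold 3/4. *)
by rewrite ler_pdivrMr//; nra.
Qed.

(** This crude bound suffices because of the 4 in [ln (4 * T%:R / delta)]; it serves both for
    [1 <= a] and for the growth of [(1 + 1/T) ^+ T]. *)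
Lemma expR1_le4 (R : realType) : expR 1 <= 4 :> R.
Proof.
have -> : (1 : R) = 2^-1 + 2^-1 by lra.
rewrite expRD; have h : expR 2^-1 <= 2 :> R.
  have := expR_ge1Dx (- 2^-1 : R); rewrite -(ler_pM2r (expR_gt0 2^-1)).
  by rewrite -expRD addNr expR0; lra.
by have := expR_gt0 (2^-1 : R); nra.
Qed.

Lemma le_powR_of_eighth (R : realType) (p r : R) : 1 <= p -> p <= 2 ->
  1 / 8 <= r -> r <= 8 * r `^ p.
Proof.
move=> p1 p2 r8; have r0 : 0 < r by lra.
have h : 8 * r <= (8 * r) `^ p.
  rewrite -{1}(@powRr1 _ (8 * r)); last by lra.
  by apply: ler_powR => //; lra.
rewrite powRM in h; [|by lra..].
have h8 : 8 `^ p <= 64 :> R.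
  rewrite (_ : 64 = 8 `^ 2); first by apply: ler_powR; lra.
  by rewrite powR_mulrn//; lra.
by have := powR_ge0 r p; nra.
Qed.

Lemma minr1_sqr_le_powR (R : realType) (p r : R) : 0 <= p -> p <= 2 -> 0 <= r ->
  Num.min 1 r ^+ 2 <= r `^ p.
Proof.
move=> p0 p2 r0; have [r1|r1] := leP 1 r.
  by rewrite expr1n -(powRr0 r); apply: ler_powR.
have [->|rn] := eqVneq r 0.
  by rewrite expr0n powR_ge0.
rewrite -powR_mulrn//; apply: ger_powR => //.
by rewrite lt_neqAle eq_sym rn r0 ltW.
Qed.

(* Only the excess [clip lam v - v] is non-linear in [v]; as [u] stays away
   from the sphere of radius [lam], it is non-zero only if the noise [v - u]
   exceeds [lam / 8], so it is bounded by the [p]-th power of the noise. *)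
Lemma expR_clip_le (R : realType) (d : nat) (p lam al be : R)
    (u v z : 'rV[R]_d) :
  1 <= p -> p <= 2 -> 0 < lam -> enorm u <= 7 / 8 * lam ->
  0 <= al -> al * enorm z * lam <= 5 / 16 ->
  0 <= be -> be * lam ^+ 2 <= 1 / 64 ->
  expR (- al * dot (clip lam v - u) z + be * enorm (clip lam v - u) ^+ 2) <=
  1 - al * dot (v - u) z + 16 * (enorm (v - u) / lam) `^ p.
Proof.
move=> p1 p2 lam0 ule al0 alz be0 bel.
set r := enorm (v - u) / lam.
have r0 : 0 <= r by rewrite divr_ge0 ?enorm_ge0// ltW.
have rE : enorm (v - u) = r * lam by rewrite divfK// gt_eqF.
set P := r `^ p; have P0 : 0 <= P by exact: powR_ge0.
have vle : enorm v <= r * lam + 7 / 8 * lam.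
  have := enormD (v - u) u; rewrite subrK rE; lra.
have exc : enorm (clip lam v - v) <= 8 * P * lam.
  rewrite enorm_clip_subr// ge_max; apply/andP; split.
    by apply: mulr_ge0 (ltW lam0); exact: mulr_ge0.
  (* For [r < 1 / 8] the norm of [v] is below [lam] and nothing is clipped; otherwise the excess is
     at most [r * lam]. *)
  have [r8|r8] := leP (1 / 8) r.
    have : r * lam <= 8 * P * lam.
      by rewrite ler_pM2r//; exact: le_powR_of_eighth.
    lra.
  have : 0 <= P * lam by rewrite mulr_ge0// ltW.
  by nra.
set th := clip lam v - u.
(* Both [clip lam v] and [u] have norm at most [lam], which gives [2 * lam]; excess plus noise gives
   [2 * r * lam]. *)
have th2 : enorm th <= 2 * lam * Num.min 1 r.
  rewrite minr_pMr; last by lra.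
  rewrite le_min mulr1; apply/andP; split.
    have := enormD (clip lam v) (- u); have := @enorm_clip_le R d lam v lam0.
    by rewrite enormN -/th; lra.
  have := enormD (clip lam v - v) (v - u); rewrite addrA subrK -/th rE.
  rewrite enorm_clip_subr//; have [?|?] := leP 0 (enorm v - lam).
    lra.
  have := mulr_ge0 r0 (ltW lam0); lra.
set m := Num.min 1 r in th2.
have m0 : 0 <= m by rewrite le_min ler01.
have m1 : m <= 1 by rewrite ge_min lexx.
have mP : m ^+ 2 <= P by apply: minr1_sqr_le_powR => //; lra.
have th0 : 0 <= enorm th := enorm_ge0 th.
have thz : al * `|dot th z| <= 5 / 8 * m.
  have h1 : al * `|dot th z| <= al * (enorm th * enorm z).
    exact: ler_wpM2l (dot_le _ _).
  have h2 : al * (enorm th * enorm z) <= al * enorm z * (2 * lam * m).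
    rewrite [leLHS](_ : _ = al * enorm z * enorm th); last by ring.
    by apply: ler_wpM2l => //; rewrite mulr_ge0// enorm_ge0.
  have h3 : al * enorm z * (2 * lam * m) = (al * enorm z * lam) * (2 * m).
    by ring.
  have : (al * enorm z * lam) * (2 * m) <= 5 / 16 * (2 * m).
    by apply: ler_wpM2r => //; lra.
  lra.
have thq : be * enorm th ^+ 2 <= 1 / 16 * m ^+ 2.
  have h1 : enorm th ^+ 2 <= (2 * lam * m) ^+ 2.
    by rewrite ler_sqr// nnegrE; exact: le_trans th2.
  have h2 : be * (2 * lam * m) ^+ 2 = (be * lam ^+ 2) * (4 * m ^+ 2) by ring.
  have h3 : (be * lam ^+ 2) * (4 * m ^+ 2) <= 1 / 64 * (4 * m ^+ 2).
    by apply: ler_wpM2r => //; have := sqr_ge0 m; lra.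
  have := ler_wpM2l be0 h1; lra.
have thq0 : 0 <= be * enorm th ^+ 2 by rewrite mulr_ge0// sqr_ge0.
set q := be * enorm th ^+ 2 in thq thq0 *.
have excz : al * `|dot (clip lam v - v) z| <= 5 / 2 * P.
  have h1 : al * `|dot (clip lam v - v) z| <= al * (8 * P * lam * enorm z).
    apply: ler_wpM2l => //; apply: (le_trans (dot_le _ _)).
    by apply: ler_wpM2r => //; exact: enorm_ge0.
  have h2 : al * (8 * P * lam * enorm z) = (al * enorm z * lam) * (8 * P).
    by ring.
  have h3 : (al * enorm z * lam) * (8 * P) <= 5 / 16 * (8 * P).
    by apply: ler_wpM2r => //; lra.
  lra.
(* The noise part of [th] is kept exactly, since its integral will vanish; only the excess is
   estimated. *)
have thE : dot th z = dot (clip lam v - v) z + dot (v - u) z.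
  by rewrite -dotDl addrA subrK.
set A := al * dot th z.
have AE : A = al * dot (clip lam v - v) z + al * dot (v - u) z.
  by rewrite /A thE mulrDr.
have A1 : `|A| <= 5 / 8 * m by rewrite normrM (ger0_norm al0).
have A2 : `|al * dot (clip lam v - v) z| <= 5 / 2 * P.
  by rewrite normrM (ger0_norm al0).
move: A1 A2; rewrite !ler_norml => /andP[A1 A1'] /andP[A2 A2'].
rewrite mulNr -/A.
have m2 : m ^+ 2 <= m by rewrite expr2 ler_piMr.
(* The exponent is at most [5/8 * m + 1/16 * m ^+ 2 <= 11/16 * m], hence below 3/4. The coefficients
   of [P] are 5/2 from the excess, 1/16 from [q] and 4 (11/16)^2 from the square; their sum is below
   16. *)
apply: (le_trans (expR_le_quad _)); first by lra.
have : (- A + q) ^+ 2 <= (11 / 16 * m) ^+ 2.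
  rewrite -[leLHS]real_normK ?num_real// ler_sqr ?nnegrE//; last by lra.
  by rewrite ler_norml; apply/andP; split; lra.
by rewrite exprMn; lra.
Qed.

(** * Smooth convex functions *)

Section convex.
Context {R : realType} {d : nat}.
Variable f : 'rV[R]_d -> R.
Hypothesis f_diff : forall x, differentiable f x.
Implicit Types x y v : 'rV[R]_d.

Lemma derive_gradient x v : 'D_v f x = dot (gradient f x) v.
Proof.
rewrite deriveE// {1}(row_sum_delta v) linear_sum; apply: eq_bigr => j _.
by rewrite linearZ/= mxE deriveE// -[LHS]/(v 0 j * _) mulrC.
Qed.

Lemma right_derivative_gradient x v :
  (fun h => h^-1 * (f (h *: v + x) - f x)) @ 0^'+ --> dot (gradient f x) v.
Proof.
rewrite -derive_gradient; apply: cvg_dnbhs_at_right.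
exact: (@diff_derivable _ _ _ f x v (f_diff x)).
Qed.

(** The right difference quotients at [xs] along [- gradient f xs] are nonnegative, and their limit
    is minus the squared norm of the gradient. *)
Lemma gradient_min xs : (forall y, f xs <= f y) -> gradient f xs = 0.
Proof.
move=> xs_min; apply: enorm_eq0; apply/eqP.
rewrite -sqrf_eq0 eq_le sqr_ge0 andbT enorm_sqr.
have := @right_derivative_gradient xs (- gradient f xs).
move=> /(ler_cvg_to (cvg_cst 0)); rewrite dotC dotNl oppr_ge0; apply.
near=> h; have h0 : 0 < h by near: h; exact: nbhs_right_gt.
by rewrite mulr_ge0 ?invr_ge0 ?(ltW h0)// subr_ge0.
Unshelve. all: by end_near. Qed.

Hypothesis f_convex : convex_function [set: convex_lmodType 'rV[R]_d] f.

(** By convexity the difference quotients from [x] towards [y] are at most [f y - f x] for every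
    step [h] in (0, 1]; let [h] tend to 0. *)
Lemma convex_gradient_le x y : dot (gradient f x) (y - x) <= f y - f x.
Proof.
set v := y - x.
have /ler_cvg_to := @right_derivative_gradient x v.
move=> /(_ _ (f y - f x) (cvg_cst _)); apply.
near=> h; have h0 : 0 < h by near: h; exact: nbhs_right_gt.
have h1 : h <= 1 by near: h; exact: nbhs_right_le.
rewrite mulrC ler_pdivrMr// mulrC.
have := f_convex (Itv01 (ltW h0) h1) (in_setT y) (in_setT x).
rewrite -[X in f X]/(h *: y + (1 - h) *: x).
rewrite -[leRHS]/(h * f y + (1 - h) * f x).
rewrite (_ : h *: y + (1 - h) *: x = h *: v + x); first by lra.
by rewrite scalerBl scale1r /v scalerBr addrCA [RHS]addrC.
Unshelve. all: by end_near. Qed.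

(* Convexity at [x - t grad f(x)] instead of the descent lemma. *)
Lemma smooth_gradient_sqr_le (L t : R) x xs : smooth L f ->
  (forall y, f xs <= f y) -> 0 <= t -> t * L <= 1 / 2 ->
  t * enorm (gradient f x) ^+ 2 <= 2 * (f x - f xs).
Proof.
move=> f_smooth xs_min t0 tL.
set g := gradient f x; set y := x - t *: g.
have := convex_gradient_le y x; rewrite {2}/y opprB addrCA subrr addr0.
set h := gradient f y; rewrite dotZr => hle.
have gh : enorm (g - h) <= L * (t * enorm g).
  have := f_smooth x y; rewrite -/g -/h {1}/y opprB addrCA subrr addr0.
  by rewrite enormZ ger0_norm.
have gd : dot h g = enorm g ^+ 2 - dot (g - h) g.
  by rewrite dotBl -enorm_sqr; ring.
have := dot_le (g - h) g; rewrite ler_norml => /andP[_ dle].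
have g0 : 0 <= enorm g := enorm_ge0 g.
(* As [t * L <= 1 / 2], the gradient changes between [x] and [y] by at most half of its norm, so
   [dot h g] keeps half of [enorm g ^+ 2]. *)
have dle2 : dot (g - h) g <= 1 / 2 * enorm g ^+ 2.
  apply: (le_trans dle); rewrite expr2 mulrA; apply: ler_wpM2r => //.
  by apply: (le_trans gh); rewrite mulrA; apply: ler_wpM2r => //; lra.
have := xs_min y; have : t * (1 / 2 * enorm g ^+ 2) <= t * dot h g.
  by apply: ler_wpM2l => //; lra.
lra.
Qed.

Lemma smooth_gradient_le (L : R) x xs : smooth L f ->
  (forall y, f xs <= f y) -> enorm (gradient f x) <= L * enorm (x - xs).
Proof.
move=> f_smooth xs_min; have := f_smooth x xs.
by rewrite (gradient_min xs_min) subr0.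
Qed.

End convex.

(** * Borel measurability of vector-valued maps *)

Section borel.
Context {R : realType} {d : nat}.

(** Open cubes with rational centre and radius [1 / (n + 1)]: a base of the topology with a
    countable index type. *)
Let box (q : 'rV[rat]_d * nat) : set 'rV[R]_d :=
  [set v | forall j, `|v 0 j - ratr (q.1 0 j)| < q.2.+1%:R^-1].

Lemma open_bigcup_box (U : set 'rV[R]_d) : open U ->
  U = \bigcup_(q in [set q | box q `<=` U]) box q.
Proof.
move=> oU; apply/seteqP; split => [v Uv|v [q qU /qU//]].
have /nbhs_ballP[e /= e0 eU] : nbhs v U by exact: open_nbhs_nbhs.
have [n ne] : exists n, 2 * n.+1%:R^-1 < e.
  have e2 : 0 < e / 2 by rewrite divr_gt0.
  have [n _ /(_ n (leqnn n))] := near_infty_natSinv_lt (PosNum e2).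
  by rewrite /= ltr_pdivlMr// mulrC => ne; exists n.
have n0 : 0 < n.+1%:R^-1 :> R by rewrite invr_gt0.
have qP j : exists q : rat, `|v 0 j - ratr q| < n.+1%:R^-1 :> R.
  move: (n.+1%:R^-1) n0 => {ne n}e' e'0.
  have /rat_in_itvoo[q] : v 0 j - e' < v 0 j + e' by lra.
  rewrite in_itv/= => /andP[? ?]; exists q; rewrite ltr_norml.
  by apply/andP; split; lra.
have /choice[q qv] := qP.
exists (\row_j q j, n); last by move=> j /=; rewrite mxE; exact: qv.
move=> u /= un; apply: eU; split => // i j; rewrite ord1 -ball_normE/=.
move: (un j) (qv j); rewrite /box/= mxE !ltr_norml.
move: (n.+1%:R^-1) ne => e' ne' /andP[? ?] /andP[? ?].
by apply/andP; split; lra.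
Qed.

(** The preimage of an open set is a countable union of preimages of boxes, each of which is a
    finite intersection of conditions on single coordinates. *)
Lemma measurable_fun_rV dT (T : measurableType dT) (h : T -> borel_rV R d) :
  (forall j, measurable_fun setT (fun w => h w 0 j)) -> measurable_fun setT h.
Proof.
move=> mh; apply: (@measurability _ _ _ (borel_rV R d) _ _ (@open 'rV[R]_d)) => //.
move=> _ [U oU <-].
rewrite setTI (open_bigcup_box oU) preimage_bigcup bigcup_mkcond.
apply: countable_bigcupT_measurable => [|q]; first exact: countableP.
case: ifPn => // _.
rewrite [X in measurable X](_ : _ = \bigcap_(j in setT)
    [set w | `|h w 0 j - ratr (q.1 0 j)| < q.2.+1%:R^-1]); last first.
  by apply/seteqP; split => w hw => [j _|j]; exact: hw.
apply: fin_bigcap_measurable; first exact: finite_finset.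
move=> j _; rewrite -[X in measurable X]setTI.
apply: (measurable_fun_ltr (f := fun w => `|h w 0 j - ratr (q.1 0 j)|)
  (g := cst _) _ _ measurableT (Y := [set true])) => //.
by apply: measurableT_comp => //; exact: measurable_funB.
Qed.

Lemma continuous_measurable_rV (f : 'rV[R]_d -> R) :
  continuous f -> measurable_fun [set: borel_rV R d] f.
Proof.
move=> /continuousP cf; apply: (measurability _ (RGenOpens.measurableE R)).
move=> _ [_ [a [b ->] <-]]; rewrite setTI.
by apply: sub_sigma_algebra; exact/cf/interval_open.
Qed.

Lemma measurable_coord (j : 'I_d) :
  measurable_fun [set: borel_rV R d] (fun v : borel_rV R d => v 0 j : R).
Proof. by apply: continuous_measurable_rV; exact: coord_continuous. Qed.

Section comp.
Context dT (T : measurableType dT).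
Implicit Types h k : T -> borel_rV R d.

Lemma measurable_rV_coord h j : measurable_fun setT h ->
  measurable_fun setT (fun w => h w 0 j : R).
Proof. by move=> mh; exact: (measurableT_comp (measurable_coord j) mh). Qed.

Lemma measurable_enorm h : measurable_fun setT h ->
  measurable_fun setT (fun w => enorm (h w)).
Proof.
move=> mh; apply: (@measurableT_comp _ _ _ _ _ _ (@Num.sqrt R) _
  (fun w => \sum_j h w 0 j ^+ 2)).
  by apply: continuous_measurable_fun; exact: sqrt_continuous.
apply: measurable_sum => j; apply: measurable_funX; exact: measurable_rV_coord.
Qed.

Lemma measurable_rVB h k : measurable_fun setT h -> measurable_fun setT k ->
  measurable_fun setT (fun w => h w - k w : borel_rV R d).
Proof.
move=> mh mk; apply: measurable_fun_rV => j.
under eq_fun do rewrite !mxE.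
by apply: measurable_funB; exact: measurable_rV_coord.
Qed.

Lemma measurable_rVZ (c : T -> R) h : measurable_fun setT c ->
  measurable_fun setT h ->
  measurable_fun setT (fun w => c w *: h w : borel_rV R d).
Proof.
move=> mc mh; apply: measurable_fun_rV => j.
under eq_fun do rewrite !mxE.
by apply: measurable_funM => //; exact: measurable_rV_coord.
Qed.

Lemma measurable_clip (lam : R) h : measurable_fun setT h ->
  measurable_fun setT (fun w => clip lam (h w) : borel_rV R d).
Proof.
move=> mh; apply: measurable_rVZ => //; apply: measurable_minr => //.
(* The inverse is written as the real power -1, a measurable function that agrees with it also at
   0. *)
under eq_fun do rewrite -powR_inv1 ?enorm_ge0//.
apply: measurable_funM => //; apply: (measurableT_comp (measurable_powR _)).
exact: measurable_enorm.
Qed.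

End comp.
End borel.

(** * Disintegration along a kernel *)

Section disintegration.
Context dO (Omega : measurableType dO) dS (S : measurableType dS)
  dY (Y : measurableType dY) (R : realType).
Variables (P : probability Omega R) (X : Omega -> S) (G : Omega -> Y).
Hypotheses (mX : measurable_fun setT X) (mG : measurable_fun setT G).
Variable K : R.-pker S ~> Y.

(* The kernel that sends [w] to the law of [(X w, v)] with [v] drawn from
   [K (X w)]; the first component of the source is a dummy parameter required
   by [kcomp]. *)
Let pairK (z : unit * Omega) : {measure set (S * Y) -> \bar R} :=
  measure_function_pushforward__canonical__measure_function_Measure
    (K (X z.2)) (pair1_measurable (X z.2)).

Let pairKE z C : pairK z C = K (X z.2) (xsection C (X z.2)).
Proof. by rewrite xsectionE. Qed.

Let measurable_pairK C : measurable C -> 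
  measurable_fun setT (pairK ^~ C : unit * Omega -> \bar R).
Proof.
move=> mC; have -> : pairK ^~ C = fun z => K (X z.2) (xsection C (X z.2)).
  by apply/funext => z; exact: pairKE.
apply: (measurableT_comp
  (measurable_fun_xsection_finite_kernel K (mem_set mC)) (g := X \o snd)).
exact: measurableT_comp.
Qed.

HB.instance Definition _ := isKernel.Build _ _ _ _ _ pairK measurable_pairK.

Let pairK_setT z : pairK z setT = 1%E.
Proof. by rewrite pairKE xsectionE prob_kernel. Qed.

HB.instance Definition _ :=
  Kernel_isProbability.Build _ _ _ _ _ pairK pairK_setT.

(** [P] seen as a kernel from the one-point space, to be composed with [pairK]. *)
Let cstP := kprobability
  (measurable_cst (P : pprobability Omega R) : measurable_fun [set: unit] _).

Hypothesis XGK : forall A B, measurable A -> measurable B ->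
  P (X @^-1` A `&` G @^-1` B) = (\int[P]_(w in X @^-1` A) K (X w) B)%E.

(** Both sides integrate [H], one against the law of [(X, G)] and the other against the composition
    of [P] with [pairK]. These measures agree on rectangles by [XGK], and rectangles form a
    generating system stable under intersection. *)
Lemma ge0_integral_disintegration (H : S * Y -> \bar R) :
  measurable_fun setT H -> (forall z, (0 <= H z)%E) ->
  (\int[P]_w H (X w, G w) = \int[P]_w \int[K (X w)]_v H (X w, v))%E.
Proof.
move=> mH H0.
have mXG : measurable_fun setT (fun w => (X w, G w)).
  exact: measurable_fun_pair.
transitivity (\int[kcomp cstP pairK tt]_z H z)%E; last first.
  rewrite integral_kcomp//=; apply: eq_integral => w _.
  by rewrite ge0_integral_pushforward.
rewrite -[LHS](@ge0_integral_pushforward _ _ _ _ _ _ mXG P setT H)//.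
apply: (@eq_measure_integral _ _ _ _
  (mkcomp cstP pairK tt)
  (measure_function_pushforward__canonical__measure_function_Measure P mXG)).
move=> C mC _.
apply: (@measure_unique _ _ _ [set A `*` B | A in measurable & B in measurable]
  (fun=> setT)) => //.
- by rewrite measurable_prod_measurableType.
- move=> _ _ [X1 mX1 [X2 mX2 <-]] [Y1 mY1 [Y2 mY2 <-]].
  exists (X1 `&` Y1); first exact: measurableI.
  by exists (X2 `&` Y2); [exact: measurableI|rewrite setXI].
- by move=> i; exists setT => //; exists setT => //; rewrite setXTT.
- by rewrite bigcup_const.
- move=> _ [A mA [B mB <-]].
  transitivity (P (X @^-1` A `&` G @^-1` B)) => //.
  rewrite XGK// integral_mkcond; apply: eq_integral => w _.
  rewrite pairKE patchE; case: ifPn => wA.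
    by rewrite in_xsectionX// inE; rewrite inE in wA.
  by rewrite notin_xsectionX ?measure0// inE; rewrite inE in wA.
- by move=> i; rewrite [ltLHS]probability_setT ltry.
Qed.

End disintegration.

(** * Exponential moment of one descent step *)

(** Expand the square with [c = th + u]. Half of the decrease [2 * eta * dot u z] absorbs
    [eta * (f x - f xs)] by convexity; the other half absorbs [2 * eta ^+ 2 * enorm u ^+ 2] by
    smoothness. What remains involves [th] alone and falls under [expR_clip_le]. *)
Lemma expR_descent_le (R : realType) (d : nat) (f : 'rV[R]_d -> R)
    (L p lam eta k : R) (x xs v : 'rV[R]_d) :
  convex_function [set: convex_lmodType 'rV[R]_d] f ->
  (forall x, differentiable f x) -> smooth L f -> (forall y, f xs <= f y) ->
  1 <= p -> p <= 2 -> 0 < lam -> 0 <= eta -> 0 <= k ->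
  L * enorm (x - xs) <= 7 / 8 * lam ->
  2 * k * eta * enorm (x - xs) * lam <= 5 / 16 ->
  2 * k * eta ^+ 2 * lam ^+ 2 <= 1 / 64 -> 4 * eta * L <= 1 / 2 ->
  expR (k * (enorm (x - eta *: clip lam v - xs) ^+ 2 - enorm (x - xs) ^+ 2 +
             eta * (f x - f xs))) <=
  1 - 2 * k * eta * dot (v - gradient f x) (x - xs) +
  16 * (enorm (v - gradient f x) / lam) `^ p.
Proof.
move=> f_convex f_diff f_smooth xs_min p1 p2 lam0 eta0 k0 Lz kz kl etaL.
set u := gradient f x; set z := x - xs; set c := clip lam v.
have ule : enorm u <= 7 / 8 * lam.
  exact: le_trans (smooth_gradient_le f_diff _ f_smooth xs_min) Lz.
have u2 : 4 * eta * enorm u ^+ 2 <= 2 * (f x - f xs).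
  apply: (smooth_gradient_sqr_le f_diff f_convex _ f_smooth xs_min) => //.
  by rewrite mulr_ge0.
have uz : f x - f xs <= dot u z.
  have := convex_gradient_le f_diff f_convex x xs.
  by rewrite -opprB -/z -/u -scaleN1r dotZr; lra.
apply: le_trans (@expR_clip_le R d p lam (2 * k * eta) (2 * k * eta ^+ 2) u v z
  p1 p2 lam0 ule _ kz _ kl); rewrite ?mulr_ge0 ?sqr_ge0//.
rewrite ler_expR -/c.
have -> : x - eta *: c - xs = z - eta *: c by rewrite addrAC.
set th := c - u.
have cE : c = th + u by rewrite subrK.
have c2 : enorm c ^+ 2 <= 2 * enorm th ^+ 2 + 2 * enorm u ^+ 2.
  by rewrite cE enormD_sqr_le.
have -> : enorm (z - eta *: c) ^+ 2 =
    enorm z ^+ 2 - 2 * eta * dot c z + eta ^+ 2 * enorm c ^+ 2.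
  by rewrite enormB_sqr dotZr enormZ (ger0_norm eta0) (dotC z c); ring.
have -> : dot c z = dot th z + dot u z by rewrite cE dotDl.
have h1 : eta ^+ 2 * enorm c ^+ 2 <=
    2 * eta ^+ 2 * enorm th ^+ 2 + 2 * eta ^+ 2 * enorm u ^+ 2.
  by have := ler_wpM2l (sqr_ge0 eta) c2; lra.
have h2 : 2 * eta ^+ 2 * enorm u ^+ 2 <= eta * (f x - f xs).
  by have := ler_wpM2l eta0 u2; lra.
have h3 : eta * (f x - f xs) <= eta * dot u z by exact: ler_wpM2l.
have := ler_wpM2l k0 (_ : - (2 * eta * (dot th z + dot u z)) +
  eta ^+ 2 * enorm c ^+ 2 + eta * (f x - f xs) <=
  - (2 * eta * dot th z) + 2 * eta ^+ 2 * enorm th ^+ 2).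
move=> /(_ ltac:(lra)) h4.
by lra.
Qed.

(** * Integrals of the answer of an unbiased oracle *)

Section oracle.
Context {R : realType} {d : nat}.
Variable mu : {measure set (borel_rV R d) -> \bar R}.
Hypothesis mu1 : mu setT = 1%E.
Variable u : 'rV[R]_d.
Hypothesis int_u : forall j : 'I_d,
  mu.-integrable setT (fun v : borel_rV R d => (v 0 j)%:E) /\
  (\int[mu]_v (v 0 j)%:E = (u 0 j)%:E)%E.

Lemma integrable_dot (z : 'rV[R]_d) :
  mu.-integrable setT (fun v : borel_rV R d => (dot v z)%:E).
Proof.
rewrite (_ : (fun v => _) = fun v : borel_rV R d =>
    (\sum_j (v 0 j * z 0 j)%:E)%E); last first.
  by apply/funext => v; rewrite sumEFin.
apply: integrable_sum => // j _.
under eq_fun do rewrite EFinM muleC.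
by apply: integrableZl => //; case: (int_u j).
Qed.

Lemma integral_dot (z : 'rV[R]_d) :
  (\int[mu]_v (dot v z)%:E = (dot u z)%:E)%E.
Proof.
under eq_integral do rewrite -sumEFin.
rewrite integral_sum//; last first.
  move=> j; under eq_fun do rewrite EFinM muleC.
  by apply: integrableZl => //; case: (int_u j).
rewrite -sumEFin; apply: eq_bigr => j _.
under eq_integral do rewrite EFinM muleC.
by case: (int_u j) => iu uE; rewrite integralZl// uE -EFinM mulrC.
Qed.

Lemma integral_noise_le (p s al C : R) (z : 'rV[R]_d) :
  (\int[mu]_v (enorm (v - u) `^ p)%:E <= (s `^ p)%:E)%E -> 0 <= C ->
  (\int[mu]_v (1 - al * dot (v - u) z + C * enorm (v - u) `^ p)%:E
    <= (1 + C * s `^ p)%:E)%E.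
Proof.
move=> mom C0.
have mp : measurable_fun [set: borel_rV R d] (fun v => enorm (v - u) `^ p).
  apply: (measurableT_comp (measurable_powR _)).
  by apply: measurable_enorm; exact: measurable_rVB.
have ip : mu.-integrable setT (fun v : borel_rV R d => (enorm (v - u) `^ p)%:E).
  apply/integrableP; split; first exact/measurable_EFinP.
  under eq_integral do rewrite gee0_abs ?lee_fin ?powR_ge0//.
  by apply: (le_lt_trans mom); rewrite ltry.
have ic (c : R) : mu.-integrable setT (fun=> c%:E).
  apply/integrableP; split; first exact: measurable_cst.
  by rewrite integral_cst// mu1 mule1 ltry.
under eq_integral => v _.
  rewrite (_ : _ + _ = (1 + al * dot u z) + (- al * dot v z) +
    C * enorm (v - u) `^ p); last by rewrite dotBl; ring.
  rewrite EFinD EFinM EFinD EFinM; over.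
rewrite integralD//=; last 2 first.
- by apply: integrableD => //; apply: integrableZl => //; exact: integrable_dot.
- by apply: integrableZl.
rewrite integralD//=; last by apply: integrableZl => //; exact: integrable_dot.
rewrite integral_cst// mu1 mule1 integralZl//; last exact: integrable_dot.
rewrite integral_dot integralZl// -EFinM -EFinD.
(* Unbiasedness: the constant [al * dot u z] cancels the integral of [- al * dot v z]. *)
rewrite (_ : 1 + _ + _ = 1); last by ring.
by rewrite [leRHS]EFinD leeD2l// EFinM lee_wpmul2l.
Qed.

End oracle.

Section descent.
Context {R : realType} {d : nat}.
Variables (f : 'rV[R]_d -> R) (L : R) (xs : 'rV[R]_d).
Hypothesis f_convex : convex_function [set: convex_lmodType 'rV[R]_d] f.
Hypothesis f_diff : forall x, differentiable f x.
Hypothesis f_smooth : smooth L f.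
Hypothesis xs_min : forall y, f xs <= f y.
Variables (p sigma : R).
Hypotheses (p1 : 1 <= p) (p2 : p <= 2).
Variable Q : R.-pker (borel_rV R d) ~> (borel_rV R d).
Hypothesis Q_unbiased : unbiased f Q.
Hypothesis Q_moment : moment_bounded f p sigma Q.
Variables (T : nat) (lam eta k B : R).
Hypotheses (T0 : (0 < T)%N) (lam0 : 0 < lam) (eta0 : 0 <= eta) (k0 : 0 <= k).
Hypothesis lam_noise : 16 * T%:R * sigma `^ p <= lam `^ p.
Hypothesis gradB : forall z : 'rV[R]_d, enorm z ^+ 2 <= B ->
  L * enorm z <= 7 / 8 * lam.
Hypothesis stepB : forall z : 'rV[R]_d, enorm z ^+ 2 <= B ->
  2 * k * eta * enorm z * lam <= 5 / 16.
Hypothesis step_sqr : 2 * k * eta ^+ 2 * lam ^+ 2 <= 1 / 64.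
Hypothesis step_smooth : 4 * eta * L <= 1 / 2.

(* A state consists of an iterate [x] and of the potential
   [|x_t - xs|^2 + eta * \sum_(s < t) (f x_s - f xs)], frozen once it exceeds
   [B]; the bound on [|x - xs|^2] follows from the bound on the potential along
   a run, but makes the one-step estimate hold from every state. *)
Let state : Type := (borel_rV R d * R)%type.

Definition potential_step (s : state) (v : borel_rV R d) : state :=
  let y := s.1 - eta *: clip lam v in
  (y, if (s.2 <= B) && (enorm (s.1 - xs) ^+ 2 <= B)
      then s.2 + (enorm (y - xs) ^+ 2 - enorm (s.1 - xs) ^+ 2 +
                  eta * (f s.1 - f xs))
      else s.2).

Lemma measurable_objective : measurable_fun [set: borel_rV R d] f.
Proof.
by apply: continuous_measurable_rV => x; exact: differentiable_continuous.
Qed.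

Lemma measurable_potential_step dA (A : measurableType dA)
    (s : A -> borel_rV R d * R) (v : A -> borel_rV R d) :
  measurable_fun setT s -> measurable_fun setT v ->
  measurable_fun setT (fun w => potential_step (s w) (v w)).
Proof.
move=> ms mv.
have ms1 : measurable_fun setT (fun w => (s w).1).
  exact: measurableT_comp ms.
have ms2 : measurable_fun setT (fun w => (s w).2).
  exact: measurableT_comp ms.
have my : measurable_fun setT
    (fun w => (s w).1 - eta *: clip lam (v w) : borel_rV R d).
  apply: measurable_rVB => //.
  by apply: measurable_rVZ => //; exact: measurable_clip.
have mD (h : A -> borel_rV R d) : measurable_fun setT h ->
    measurable_fun setT (fun w => enorm (h w - xs) ^+ 2).
  move=> mh; apply: measurable_funX.
  by apply: measurable_enorm; exact: measurable_rVB.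
apply: measurable_fun_pair => //=.
apply: measurable_fun_ifT => //.
  by apply: measurable_and; apply: measurable_fun_ler => //; exact: mD.
apply: measurable_funD => //; apply: measurable_funD.
  by apply: measurable_funB; exact: mD.
apply: measurable_funM => //; apply: measurable_funB => //.
exact: measurableT_comp measurable_objective ms1.
Qed.

(** A frozen state costs nothing. Otherwise integrate the pointwise bound of [expR_descent_le]: the
    linear term vanishes and the moment term is [16 * lam^-1]^ p * sigma [^ p], at most [1 / T] by
    [lam_noise]. *)
Lemma potential_step_expR_le (s : state) :
  (\int[Q s.1]_v (expR (k * (potential_step s v).2))%:E <=
   ((1 + T%:R^-1) * expR (k * s.2))%:E)%E.
Proof.
have T0' : 0 < T%:R :> R by rewrite ltr0n.
have es0 : 0 <= expR (k * s.2) by exact: expR_ge0.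
rewrite /potential_step /=.
have [/andP[_ sB]|_] := boolP ((s.2 <= B) && (enorm (s.1 - xs) ^+ 2 <= B));
  last first.
  rewrite integral_cst// prob_kernel mule1 lee_fin ler_peMl// lerDl.
  by rewrite invr_ge0 ltW.
set x := s.1; set u := gradient f x.
have mv : measurable_fun [set: borel_rV R d] (fun v : borel_rV R d => v).
  exact: measurable_id.
pose C := 16 * lam^-1 `^ p.
have C0 : 0 <= C by rewrite mulr_ge0// powR_ge0.
pose h v := 1 - 2 * k * eta * dot (v - u) (x - xs) + C * enorm (v - u) `^ p.
pose I (v : borel_rV R d) := enorm (x - eta *: clip lam v - xs) ^+ 2 -
  enorm (x - xs) ^+ 2 + eta * (f x - f xs).
have Ih v : expR (k * I v) <= h v.
  have := @expR_descent_le R d f L p lam eta k x xs v f_convex f_diff f_smooth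
    xs_min p1 p2 lam0 eta0 k0 (gradB sB) (stepB sB) step_sqr step_smooth.
  rewrite /h /C (_ : 16 * lam^-1 `^ p * _ = 16 * (enorm (v - u) / lam) `^ p)//.
  by rewrite powRM ?enorm_ge0 ?invr_ge0 ?ltW//; ring.
have mI : measurable_fun setT I.
  apply: measurable_funD => //; apply: measurable_funB => //.
  apply: measurable_funX; apply: measurable_enorm; apply: measurable_rVB => //.
  apply: measurable_rVB => //; apply: measurable_rVZ => //.
  exact: measurable_clip.
have mh : measurable_fun [set: borel_rV R d] h.
  apply: measurable_funD.
    apply: measurable_funB => //; apply: measurable_funM => //.
    apply: measurable_sum => j; apply: measurable_funM => //.
    by apply: measurable_rV_coord; exact: measurable_rVB.
  apply: measurable_funM => //; apply: (measurableT_comp (measurable_powR _)).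
  by apply: measurable_enorm; exact: measurable_rVB.
apply: (@le_trans _ _ (\int[Q x]_v ((expR (k * s.2))%:E * (h v)%:E))%E).
  apply: ge0_le_integral => //.
  - apply/measurable_EFinP; apply: (measurableT_comp (@measurable_expR R)).
    by apply: measurable_funM => //; apply: measurable_funD.
  - by apply/measurable_EFinP; apply: measurable_funM.
  - move=> v _; rewrite -EFinM lee_fin mulrDr expRD ler_wpM2l//; exact: Ih.
rewrite ge0_integralZl//; last 2 first.
- exact/measurable_EFinP.
- by move=> v _; rewrite lee_fin (le_trans _ (Ih v))// expR_ge0.
rewrite (mulrC (1 + _)) EFinM lee_wpmul2l//.
have := integral_noise_le (prob_kernel x) (Q_unbiased x) (2 * k * eta) (x - xs)
  (Q_moment x) C0.
move=> /le_trans; apply; rewrite lee_fin lerD2l /C.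
rewrite -(ler_pM2r T0') mulVf ?gt_eqF//.
have lV : lam^-1 `^ p * lam `^ p = 1.
  by rewrite -powRM ?invr_ge0 ?ltW// mulVf ?gt_eqF// powR1.
have := ler_wpM2l (powR_ge0 lam^-1 p) lam_noise; rewrite lV.
by apply: le_trans; rewrite le_eqVlt; apply/orP; left; apply/eqP; ring.
Qed.

End descent.

(** * The frozen potential along a run *)

Section run.
Context {R : realType} {d : nat}.
Variables (f : 'rV[R]_d -> R) (xs : 'rV[R]_d) (lam eta B : R) (x1 : 'rV[R]_d).
Hypothesis f_diff : forall x, differentiable f x.

Let step := potential_step f xs lam eta B.

(* [potential_run g n] is the state before round [n.+1]. *)
Fixpoint potential_run (A : Type) (g : nat -> A -> borel_rV R d) (n : nat)
    (w : A) : borel_rV R d * R :=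
  if n is m.+1 then step (potential_run g m w) (g n w)
  else (x1, enorm (x1 - xs) ^+ 2).

Lemma measurable_potential_run dA (A : measurableType dA)
    (g : nat -> A -> borel_rV R d) n :
  (forall s, (1 <= s <= n)%N -> measurable_fun setT (g s)) ->
  measurable_fun setT (potential_run g n).
Proof.
elim: n => [|n IH] mg; first exact: measurable_cst.
apply: measurable_potential_step => //; last by apply: mg; rewrite ltnS leqnn.
by apply: IH => s /andP[s1 sn]; apply: mg; rewrite s1 leqW.
Qed.

(** The state is a measurable function of the first [n] answers, so the measurability lemma is
    applied on [A] equipped with the sigma-algebra that these answers generate. *)
Lemma history_potential_run (A : pointedType) (g : nat -> A -> borel_rV R d) n
    (C : set (borel_rV R d * R)) :
  measurable C -> history g n.+1 (potential_run g n @^-1` C).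
Proof.
move=> mC.
pose G := \bigcup_(s in [set s | (1 <= s < n.+1)%N])
  preimage_set_system setT (g s) measurable.
rewrite /history -/G -[X in <<s _ >> X]setTI.
apply: (@measurable_potential_run _ (g_sigma_algebraType G)) => // s sn _ Y mY.
by apply: sub_sigma_algebra; exists s => //; exists Y.
Qed.

Lemma potential_run_iterate (A : Type) (N : nat) (g x : nat -> A -> 'rV[R]_d) :
  clipped_sgd x1 (fun=> eta) (fun=> lam) N g x ->
  forall n w, (n <= N)%N -> (potential_run g n w).1 = x n.+1 w.
Proof.
move=> [x1E xE] n w; elim: n => [|n IH] nN; first by rewrite x1E.
by rewrite xE// /= IH// ltnW.
Qed.

(** A potential that ends below [B] was never frozen: exceeding [B] once would keep it above [B].
    The test on the distance also passes each time, because the potential dominates the squared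
    distance. *)
Lemma potential_runE (A : Type) (g : nat -> A -> 'rV[R]_d) n w :
  0 <= eta -> (forall y, f xs <= f y) ->
  (potential_run g n w).2 <= B ->
  (potential_run g n w).2 = enorm ((potential_run g n w).1 - xs) ^+ 2 +
    eta * \sum_(m < n) (f (potential_run g m w).1 - f xs).
Proof.
move=> eta0 xs_min; elim: n => [|n IH]; first by rewrite big_ord0 mulr0 addr0.
rewrite /= big_ord_recr/=.
set s := potential_run g n w in IH *.
set D := \sum_(m < n) _ in IH *.
have D0 : 0 <= eta * D.
  by apply: mulr_ge0 => //; apply: sumr_ge0 => m _; rewrite subr_ge0.
have [sB2|Bs] := leP s.2 B => /=; last by rewrite leNgt Bs.
have s2E := IH sB2.
have -> : enorm (s.1 - xs) ^+ 2 <= B by rewrite (le_trans _ sB2)// s2E lerDl.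
by move=> _; rewrite s2E; ring.
Qed.

End run.

Section fst_kernel.
Context dX (X : measurableType dX) dZ (Z : measurableType dZ)
  dY (Y : measurableType dY) (R : realType) (Q : R.-pker X ~> Y).

(** The oracle reads only the iterate, but conditioning is on the whole state, so its law is lifted
    to pairs. *)
Definition fst_kernel (s : X * Z) : {measure set Y -> \bar R} := Q s.1.

Let measurable_fst_kernel B : measurable B ->
  measurable_fun setT (fst_kernel ^~ B : X * Z -> \bar R).
Proof.
by move=> mB; exact: measurableT_comp (measurable_kernel Q _ mB) measurable_fst.
Qed.

HB.instance Definition _ :=
  isKernel.Build _ _ _ _ _ fst_kernel measurable_fst_kernel.

Let fst_kernel_setT s : fst_kernel s setT = 1%E.
Proof. exact: prob_kernel. Qed.

HB.instance Definition _ :=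
  Kernel_isProbability.Build _ _ _ _ _ fst_kernel fst_kernel_setT.

End fst_kernel.

(** * Exponential moment of the potential and Markov's inequality *)

Section drift.
Context {R : realType} {d : nat} dO (Omega : measurableType dO).
Variables (f : 'rV[R]_d -> R) (xs : 'rV[R]_d) (lam eta B k rho : R).
Variables (x1 : 'rV[R]_d) (P : probability Omega R).
Variable Q : R.-pker (borel_rV R d) ~> (borel_rV R d).
Variables (N : nat) (g x : nat -> Omega -> borel_rV R d).
Hypothesis f_diff : forall x, differentiable f x.
Hypothesis x_run : clipped_sgd x1 (fun=> eta) (fun=> lam) N g x.
Hypothesis g_answers : answers P Q N x g.
Hypothesis rho0 : 0 <= rho.
Hypothesis step_le : forall s : borel_rV R d * R,
  (\int[Q s.1]_v (expR (k * (potential_step f xs lam eta B s v).2))%:E <=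
   (rho * expR (k * s.2))%:E)%E.

Let run := potential_run f xs lam eta B x1 g.

Let measurable_run n : (n <= N)%N -> measurable_fun setT (run n).
Proof.
move=> nN; apply: measurable_potential_run => // s /andP[s1 sn].
by have [] := g_answers (t := s) _; first by rewrite s1 (leq_trans sn).
Qed.

Lemma expectation_expR_le n : (n <= N)%N ->
  (\int[P]_w (expR (k * (run n w).2))%:E <=
   (rho ^+ n * expR (k * enorm (x1 - xs) ^+ 2))%:E)%E.
Proof.
elim: n => [|n IH] nN.
  by rewrite expr0 mul1r /= integral_cst//= probability_setT mule1.
have [mg gQ] := g_answers (t := n.+1) nN.
have mrun : measurable_fun setT (run n) by apply: measurable_run; exact: ltnW.
pose H (z : (borel_rV R d * R) * borel_rV R d) : \bar R :=
  (expR (k * (potential_step f xs lam eta B z.1 z.2).2))%:E.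
have mH : measurable_fun setT H.
  apply/measurable_EFinP; apply: (measurableT_comp (@measurable_expR R)).
  apply: measurable_funM => //; apply: (measurableT_comp measurable_snd).
  exact: measurable_potential_step.
(* Condition on the state before the round: events about it belong to the history, so [answers]
   yields the law of the next answer. *)
rewrite -[leLHS]/(\int[P]_w H (run n w, g n.+1 w))%E.
rewrite (ge0_integral_disintegration mrun mg (K := fst_kernel Q))//;
  last first.
- by move=> z; rewrite lee_fin expR_ge0.
- move=> A C mA mC; rewrite gQ//; last exact: history_potential_run.
  apply: eq_integral => w _; rewrite /= /fst_kernel.
  by rewrite (potential_run_iterate _ _ _ x_run)// ltnW.
apply: (@le_trans _ _ (\int[P]_w (rho%:E * (expR (k * (run n w).2))%:E))%E).
  apply: ge0_le_integral => //.
  - by move=> w _; apply: integral_ge0 => v _; rewrite lee_fin expR_ge0.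
  - apply: (measurableT_comp (measurable_kfcomp (fst_kernel Q) mH _) mrun).
    by move=> z; rewrite lee_fin expR_ge0.
  - apply/measurable_EFinP; apply: measurable_funM => //.
    apply: (measurableT_comp (@measurable_expR R)).
    by apply: measurable_funM => //; exact: (measurableT_comp measurable_snd).
  - by move=> w _; exact: step_le.
rewrite ge0_integralZl//; last first.
  apply/measurable_EFinP; apply: (measurableT_comp (@measurable_expR R)).
  by apply: measurable_funM => //; exact: (measurableT_comp measurable_snd).
rewrite exprS -mulrA EFinM lee_wpmul2l ?lee_fin//.
exact: IH (ltnW nN).
Qed.

(** Markov's inequality for [expR (k * _)] at the level [expR (k * B)]. *)
Lemma probability_potential_gt : 0 <= k ->
  (P [set w | B < (run N w).2]%R <=
   (rho ^+ N * expR (k * (enorm (x1 - xs) ^+ 2 - B)))%:E)%E.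
Proof.
move=> k0; set A := [set w | _].
have mrun := measurable_run (leqnn N).
have mA : measurable A.
  rewrite -[X in measurable X]setTI.
  apply: (measurable_fun_ltr (f := cst B) (g := fun w => (run N w).2)
    _ _ measurableT (Y := [set true])) => //.
  exact: (measurableT_comp measurable_snd).
have me : measurable_fun setT (fun w => (expR (k * (run N w).2))%:E).
  apply/measurable_EFinP; apply: (measurableT_comp (@measurable_expR R)).
  by apply: measurable_funM => //; exact: (measurableT_comp measurable_snd).
have PA : ((expR (k * B))%:E * P A <=
    (rho ^+ N * expR (k * enorm (x1 - xs) ^+ 2))%:E)%E.
  rewrite -(integral_cst P mA).
  apply: (le_trans _ (expectation_expR_le (leqnn N))).
  apply: (@le_trans _ _ (\int[P]_(w in A) (expR (k * (run N w).2))%:E)%E).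
    apply: ge0_le_integral => //.
    - by move=> w _; rewrite lee_fin expR_ge0.
    - exact: measurable_funTS.
    - by move=> w Aw; rewrite lee_fin ler_expR ler_wpM2l// ltW.
  by apply: ge0_subset_integral => // w _; rewrite lee_fin expR_ge0.
rewrite mulrBr expRD expRN mulrA EFinM lee_pdivlMr ?expR_gt0//.
by rewrite muleC.
Qed.

End drift.

(** * Choice of the parameters *)

Lemma oracle_noise_le (R : realType) (p sigma c lam : R) : 1 <= p ->
  0 <= sigma -> 0 <= c -> c `^ p^-1 * sigma <= lam ->
  c * sigma `^ p <= lam `^ p.
Proof.
move=> p1 sigma0 c0 clam; have p0 : 0 < p by lra.
apply: (@le_trans _ _ ((c `^ p^-1 * sigma) `^ p)).
  by rewrite powRM ?powR_ge0// -powRrM mulVf ?gt_eqF// powRr1.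
have cs0 : 0 <= c `^ p^-1 * sigma by rewrite mulr_ge0 ?powR_ge0.
by apply: ge0_ler_powR; rewrite ?nnegrE ?(ltW p0) ?(le_trans cs0).
Qed.

(** Identifies the maximum in the stated rate with [lam / T]. *)
Lemma max_rateE (R : realType) (p sigma t b : R) : 0 < p -> 0 < t ->
  Num.max ((16 * t) `^ p^-1 * sigma) b / t =
  Num.max (16 `^ p^-1 * t `^ ((1 - p) / p) * sigma) (b / t).
Proof.
move=> p0 t0; rewrite maxr_pMl ?invr_ge0 ?ltW//; congr Num.max.
rewrite powRM ?ltW// (_ : (1 - p) / p = p^-1 + -1); last first.
  by rewrite mulrBl mul1r divff ?gt_eqF.
rewrite powRD; last by rewrite (gt_eqF t0) implybT.
by rewrite powR_inv1 ?ltW//; ring.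
Qed.

Lemma one_plus_inv_expn_le (R : realType) (n : nat) : (0 < n)%N ->
  (1 + n%:R^-1) ^+ n <= 4 :> R.
Proof.
move=> n0; apply: le_trans (expR1_le4 R).
have h : 1 + n%:R^-1 <= expR n%:R^-1 :> R by exact: expR_ge1Dx.
have -> : expR 1 = expR n%:R^-1 ^+ n :> R.
  by rewrite -expRM_natl mulfV// pnatr_eq0 -lt0n.
by apply: lerXn2r => //; rewrite nnegrE ?expR_ge0// addr_ge0// invr_ge0.
Qed.

Section parameters.
Context {R : realType}.
Variables (a L R1 lam : R).
Hypotheses (a1 : 1 <= a) (R1_gt0 : 0 < R1) (lam0 : 0 < lam).
Hypothesis lamL : Num.sqrt 2 * L * R1 <= lam.
Let eta := R1 / (16 * lam * a).
(** Chosen so that the gap [R1 ^+ 2 / 2] between the initial potential and the freezing level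
    contributes exactly [a] to the exponent. *)
Let k := 2 * a / R1 ^+ 2.
Let a0 : 0 < a.
Proof. exact: lt_le_trans ltr01 a1. Qed.

Lemma clip_radius_gradient_le (z : R) : 0 <= z -> z ^+ 2 <= 3 / 2 * R1 ^+ 2 ->
  L * z <= 7 / 8 * lam.
Proof.
move=> z0 zB; have [L0|L0] := leP L 0.
  by apply: (@le_trans _ _ 0); [rewrite mulr_le0_ge0|rewrite mulr_ge0// ltW].
have s2 : (Num.sqrt 2 : R) ^+ 2 = 2 by rewrite sqr_sqrtr.
have h1 : 2 * (L ^+ 2 * R1 ^+ 2) <= lam ^+ 2.
  rewrite (_ : 2 * _ = (Num.sqrt 2 * L * R1) ^+ 2); last first.
    by rewrite !exprMn s2; ring.
  by rewrite ler_sqr// nnegrE ?ltW// !mulr_gt0// sqrtr_gt0.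
have Lz0 : 0 <= L * z by rewrite mulr_ge0// ltW.
rewrite -ler_sqr ?nnegrE//; last by rewrite mulr_ge0// ltW.
rewrite !exprMn.
(* The squares satisfy [L ^+ 2 * z ^+ 2 <= 3/4 * lam ^+ 2], and 3/4 is below (7/8)^2 = 49/64. *)
have := ler_wpM2l (sqr_ge0 L) zB; have := sqr_ge0 lam; lra.
Qed.

Lemma clip_stepE (z : R) : 2 * k * eta * z * lam = z / (4 * R1).
Proof. by rewrite /k /eta; field; rewrite !gt_eqF. Qed.

Lemma clip_step_le (z : R) : 0 <= z -> z ^+ 2 <= 3 / 2 * R1 ^+ 2 ->
  2 * k * eta * z * lam <= 5 / 16.
Proof.
move=> z0 zB; rewrite clip_stepE ler_pdivrMr ?mulr_gt0//.
rewrite (_ : 5 / 16 * (4 * R1) = 5 / 4 * R1); last by field.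
rewrite -ler_sqr ?nnegrE//; last by rewrite mulr_ge0// ltW.
(* This is 3/2 <= (5/4)^2. *)
by rewrite exprMn; have := sqr_ge0 R1; lra.
Qed.

Lemma clip_step_sqr_le : 2 * k * eta ^+ 2 * lam ^+ 2 <= 1 / 64.
Proof.
rewrite (_ : _ * lam ^+ 2 = (64 * a)^-1); last first.
  by rewrite /k /eta; field; rewrite !gt_eqF.
by rewrite div1r lef_pV2 ?posrE ?mulr_gt0// ler_peMr.
Qed.

Lemma clip_step_smooth_le : 4 * eta * L <= 1 / 2.
Proof.
have eta0 : 0 < eta by rewrite divr_gt0// !mulr_gt0.
have [L0|L0] := leP L 0.
  by have := mulr_ge0_le0 (ltW eta0) L0; lra.
have s1 : 1 <= Num.sqrt 2 :> R by rewrite -{1}(@sqrtr1 R) ler_sqrt; lra.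
have LR : L * R1 <= lam.
  apply: le_trans lamL; rewrite -mulrA ler_peMl// mulr_ge0 ?ltW//.
rewrite (_ : 4 * eta * L = L * R1 / (4 * lam * a)); last first.
  by rewrite /eta; field; rewrite !gt_eqF.
rewrite ler_pdivrMr ?mulr_gt0//.
have : lam <= lam * a by rewrite ler_peMr// ltW.
by have := LR; have := lam0; lra.
Qed.

(** Dividing by [eta] gives the constant 3/2 * 16 = 24, which leaves room below 32. *)
Lemma clip_rate_le (s t : R) : 0 < t -> eta * s <= 3 / 2 * R1 ^+ 2 ->
  t^-1 * s <= 32 * R1 * a * (lam / t).
Proof.
move=> t0; rewrite /eta mulrAC ler_pdivrMr ?mulr_gt0// => h.
rewrite (mulrC t^-1) mulrA ler_pM2r ?invr_gt0//.
rewrite -(ler_pM2r R1_gt0) mulrC; apply: (le_trans h).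
have : 0 <= R1 ^+ 2 * lam * a by rewrite !mulr_ge0 ?ltW.
rewrite expr2; lra.
Qed.

Lemma clip_exponentE : k * (R1 ^+ 2 - 3 / 2 * R1 ^+ 2) = - a.
Proof. by rewrite /k; field; rewrite gt_eqF. Qed.

End parameters.

Theorem theorem3 (R : realType) (d : nat)
  (f : 'rV[R]_d -> R) (L : R) (xs : 'rV[R]_d)
  (f_convex : convex_function [set: convex_lmodType 'rV[R]_d] f)
  (f_diff : forall x, differentiable f x)
  (f_smooth : smooth L f)
  (xs_min : forall y, f xs <= f y)
  (p sigma : R) (p_gt1 : 1 < p) (p_le2 : p <= 2) (sigma_gt0 : 0 < sigma)
  (Q : R.-pker (borel_rV R d) ~> (borel_rV R d))
  (Q_unbiased : unbiased f Q)
  (Q_moment : moment_bounded f p sigma Q)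
  (T : nat) (T_ge1 : (1 <= T)%N)
  (delta : R) (delta_gt0 : 0 < delta) (delta_lt1 : delta < 1)
  (x1 : 'rV[R]_d) (R1 lam eta : R)
  (R1E : R1 = enorm (x1 - xs))
  (lamE : lam = Num.max ((16 * T%:R) `^ p^-1 * sigma) (Num.sqrt 2 * L * R1))
  (etaE : eta = R1 / (16 * lam * ln (4 * T%:R / delta)))
  (dO : measure_display) (Omega : measurableType dO) (P : probability Omega R)
  (g : nat -> Omega -> borel_rV R d) (x : nat -> Omega -> 'rV[R]_d)
  (x_run : clipped_sgd x1 (fun=> eta) (fun=> lam) T g x)
  (g_answers : answers P Q T x g) :
  ((1 - delta)%:E <=
   P [set w | (T%:R^-1 * \sum_(1 <= t < T.+1) (f (x t w) - f xs) <=
               32 * R1 * ln (4 * T%:R / delta) *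
               Num.max (16 `^ p^-1 * T%:R `^ ((1 - p) / p) * sigma)
                       (Num.sqrt 2 * L * R1 * T%:R^-1))%R])%E.
Proof.
have T0 : (0 < T)%N := T_ge1.
have tT0 : 0 < T%:R :> R by rewrite ltr0n.
have p0 : 0 < p by exact: lt_trans p_gt1.
have lam0 : 0 < lam.
  rewrite lamE lt_max; apply/orP; left.
  by rewrite mulr_gt0// powR_gt0// mulr_gt0.
set a := ln (4 * T%:R / delta) in etaE *.
have ratio4 : 4 <= 4 * T%:R / delta.
  rewrite ler_pdivlMr//; have : 1 <= T%:R :> R by rewrite ler1n.
  by have := ltW delta_lt1; lra.
have ratio0 : 0 < 4 * T%:R / delta by rewrite (lt_le_trans _ ratio4).
have a1 : 1 <= a.
  by rewrite -ler_expR lnK ?posrE// (le_trans (expR1_le4 R)).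
have a0 : 0 < a by exact: lt_le_trans a1.
have R1_ge0 : 0 <= R1 by rewrite R1E enorm_ge0.
rewrite -max_rateE// -lamE.
(* Here [k] would divide by 0. But then [eta] is 0 and every iterate equals [xs], so both sides of
   the bound vanish. *)
have [R1_0|R1_neq0] := eqVneq R1 0.
  have eta0 : eta = 0 by rewrite etaE R1_0 mul0r.
  have xE t w : (1 <= t <= T.+1)%N -> x t w = xs.
    have x1E : x1 = xs.
      by apply/eqP; rewrite -subr_eq0; apply/eqP/enorm_eq0; rewrite -R1E.
    case: x_run => xE1 xES; case: t => // t; elim: t => [|t IH] tT.
      by rewrite xE1.
    rewrite xES//= eta0 scale0r subr0; apply: IH; exact: ltnW.
  rewrite [X in P X](_ : _ = setT).
    by rewrite probability_setT lee_fin gerBl ltW.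
  apply/seteqP; split => // w _ /=; rewrite big_nat big1; last first.
    by move=> t /andP[t1 tT]; rewrite xE ?subrr// t1 ltnW.
  by rewrite mulr0 R1_0 mulr0 !mul0r.
have R1_gt0 : 0 < R1 by rewrite lt_neqAle eq_sym R1_neq0.
have lamL : Num.sqrt 2 * L * R1 <= lam by rewrite lamE le_max lexx orbT.
have lam_noise : 16 * T%:R * sigma `^ p <= lam `^ p.
  apply: oracle_noise_le; rewrite ?(ltW p_gt1) ?(ltW sigma_gt0)//.
  by rewrite lamE le_max lexx.
pose k := 2 * a / R1 ^+ 2.
pose B := 3 / 2 * R1 ^+ 2.
have k0 : 0 <= k by rewrite divr_ge0 ?sqr_ge0// mulr_ge0// ltW.
have eta0 : 0 < eta by rewrite etaE divr_gt0// !mulr_gt0.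
have step_le := potential_step_expR_le f_convex f_diff f_smooth xs_min
  (ltW p_gt1) p_le2 Q_unbiased Q_moment T0 lam0 (ltW eta0) k0 lam_noise
  (B := B).
have {}step_le : forall s : borel_rV R d * R,
  (\int[Q s.1]_v (expR (k * (potential_step f xs lam eta B s v).2))%:E <=
   ((1 + T%:R^-1) * expR (k * s.2))%:E)%E.
  apply: step_le; rewrite ?etaE.
  - by move=> z; exact: clip_radius_gradient_le (enorm_ge0 z).
  - by move=> z; exact: clip_step_le (enorm_ge0 z).
  - exact: clip_step_sqr_le.
  - exact: clip_step_smooth_le.
have rho0 : 0 <= 1 + T%:R^-1 :> R by rewrite addr_ge0// invr_ge0.
pose run := potential_run f xs lam eta B x1 g.
have mg s : (1 <= s <= T)%N -> measurable_fun setT (g s).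
  by move=> sT; case: (g_answers s sT).
have mrun n : (n <= T)%N -> measurable_fun setT (run n).
  move=> nT; apply: measurable_potential_run => // s /andP[s1 sn].
  by apply: mg; rewrite s1 (leq_trans sn).
have runx n w : (n <= T)%N -> (run n w).1 = x n.+1 w.
  exact: (potential_run_iterate _ _ _ x_run).
set E := [set w | _].
pose A := [set w | B < (run T w).2].
have mA : measurable A.
  rewrite -[X in measurable X]setTI.
  apply: (measurable_fun_ltr (f := cst B) (g := fun w => (run T w).2)
    _ _ measurableT (Y := [set true])) => //.
  exact: (measurableT_comp measurable_snd (mrun _ _)).
have PA : (P A <= delta%:E)%E.
  apply: le_trans
    (probability_potential_gt f_diff x_run g_answers rho0 step_le k0) _.
  rewrite -R1E /B clip_exponentE// lee_fin expRN lnK ?posrE//.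
  (* [(1 + 1/T) ^+ T * expR (- a)] is at most [4 * delta / (4 * T) = delta / T]. *)
  apply: (@le_trans _ _ (4 * (4 * T%:R / delta)^-1)).
    by rewrite ler_pM2r ?invr_gt0//; exact: one_plus_inv_expn_le.
  rewrite invf_div mulrA ler_pdivrMr ?mulr_gt0// mulrC.
  by rewrite ler_pM2l// ler_peMr// ler1n.
have mE : measurable E.
  rewrite -[X in measurable X]setTI.
  apply: (measurable_fun_ler (f := fun w => T%:R^-1 *
      \sum_(1 <= t < T.+1) (f (x t w) - f xs)) (g := cst _)
    _ _ measurableT (Y := [set true])) => //.
  apply: measurable_funM => //.
  under eq_fun do rewrite big_add1 big_mkord.
  apply: measurable_sum => n; apply: measurable_funB => //.
  (* The iterates are measurable as first components of the states. *)
  under eq_fun do rewrite -runx// 1?ltnW//.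
  apply: (measurableT_comp (measurable_objective f_diff)).
  by apply: (measurableT_comp measurable_fst); apply: mrun; exact: ltnW.
(* Off [A] the potential was never frozen, so it bounds [eta] times the sum of the gaps by [B]. *)
have AE : ~` A `<=` E.
  move=> w /negP; rewrite -leNgt => runB.
  have := potential_runE (ltW eta0) xs_min runB.
  rewrite -/run => runE; rewrite /E /= big_add1 big_mkord.
  apply: clip_rate_le => //; rewrite -etaE.
  rewrite (eq_bigr (fun m : 'I_T => f (run m w).1 - f xs)); last first.
    by move=> m _; rewrite runx// ltnW.
  by apply: le_trans runB; rewrite -/run runE lerDr sqr_ge0.
apply: (@le_trans _ _ (P (~` A))); last first.
  by apply: le_measure; rewrite ?inE//; exact: measurableC.
rewrite probability_setC// EFinB leeB//.
Qed.
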